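(* Let $p\ge1$, $\sigma>0$, $C_0>0$. Let $f$ be a locally integrable function on $\mathbb{R}^p$ with finite Besicovitch norm $\|f\|_B<\infty$, and suppose $f$ extends to $\mathbb{C}^p$ as an entire function satisfying $|f(z)|\le C_0e^{\sigma|z|}$ for all $z\in\mathbb{C}^p$. Then there is a constant $C_1<\infty$ (depending on $f$) such that $$|f(x)|\le C_1\prod_{j=1}^p(1+|x_j|)^p\qquad\text{for all } x=(x_1,\dots,x_p)\in\mathbb{R}^p.$$
   Context: $|z|$ denotes the Euclidean norm on $\mathbb{C}^p$. The Besicovitch norm of a locally integrable $f$ on $\mathbb{R}^p$ is $\|f\|_B=\limsup_{T\to\infty}(2T)^{-p}\int_{[-T,T]^p}|f(x)|\,dx$. *)

(* Defs.v *)
From mathcomp Require Import all_boot all_order all_algebra.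
From mathcomp Require Import all_classical all_reals all_analysis.
From mathcomp Require Import complex.
Import Order.TTheory GRing.Theory Num.Theory.
Import numFieldNormedType.Exports.
Local Open Scope ring_scope.

Definition cabs {R : rcfType} (w : complex R) : R :=
  Num.sqrt (complex.Re w ^+ 2 + complex.Im w ^+ 2).

Definition eucl_norm {R : rcfType} {p : nat} (z : 'rV[complex R]_p) : R :=
  Num.sqrt (\sum_(i < p) cabs (z ord0 i) ^+ 2).

Definition embedC {R : rcfType} {p : nat} (x : 'rV[R]_p) : 'rV[complex R]_p :=
  map_mx (fun r : R => (r%:C)%C) x.

(* Entire function on C^p : complex (Frechet) differentiable at every point,
   i.e. the differential is C-linear ('rV[C]_p is a normed module over C). *)
Definition entire {R : realType} {p : nat}
  (F : 'rV[(complex R)^o]_p -> (complex R)^o) : Prop :=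
  forall z, differentiable F z.

Definition sym_itv {R : realType} (T : R) : set R := `[- T, T]%classic.

(* Iterated Lebesgue integral over the cube [-T,T]^n of a nonnegative
   extended-real function g of the coordinates x_0,...,x_{n-1}
   (coordinates >= n are irrelevant and set to 0).  By Tonelli this is the
   Lebesgue integral over [-T,T]^n for nonnegative measurable g. *)
Fixpoint cube_int {R : realType} (T : R) (n : nat)
  (g : (nat -> R) -> \bar R) : \bar R :=
  match n with
  | 0 => g (fun _ => 0)
  | n'.+1 =>
      (\int[@lebesgue_measure R]_(t in sym_itv T)
          cube_int T n' (fun x => g (fun i => if i == n' then t else x i)))%E
  end.

Definition cube_int_abs {R : realType} {p : nat} (f : 'rV[R]_p -> complex R)
  (T : R) : \bar R :=
  cube_int T p (fun y => (cabs (f (\row_(i < p) y i)))%:E).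

Definition besicovitch_norm {R : realType} {p : nat}
  (f : 'rV[R]_p -> complex R) : \bar R :=
  limf_esup (fun T : R => (((2 * T) ^- p)%:E * cube_int_abs f T)%E)
            (+oo%R : set_system R).

(* Main.v *)
(* For G entire with |G(z)| <= A e^(s|z|), T > 0 and lam > 0,
     |G(0)| <= 3 lam int_(-T)^T |G| + 6 A e^((3 s - lam) T).   (1)
   Symmetrising, one may assume that G is real on the real axis and G(0) >= 0.
   Let psi(z) = exp(3 i lam z - lam z^2 / T).  The function
   h = (G psi - G(0)) / z extends continuously to 0, so by Goursat's theorem
   its integral around the square [-T, T] x [0, 2T] vanishes.  On the real side
   Im h = G(x) e^(-lam x^2 / T) sin(3 lam x) / x is at most 3 lam |G|; on the
   three other sides psi is at most e^(-lam T), while the imaginary part of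
   the integral of dz / z over them is at least 6/5.  This gives (1).
   Applied at x to one coordinate after the other, with T comparable to
   prod (1 + |x_j|) and lam a large multiple of sigma (so that the error term is
   bounded), (1) bounds |f(x)| by a constant times the integral of |f| over
   the cube [-2T, 2T]^p plus O(T^p), and the Besicovitch norm makes this
   O(T^p). *)
Require Import Defs.
From mathcomp Require Import all_boot all_order all_algebra.
From mathcomp Require Import all_classical all_reals all_analysis.
From mathcomp Require Import complex ring lra.
Import Order.TTheory GRing.Theory Num.Theory.
Import numFieldNormedType.Exports.
Local Open Scope ring_scope.

(** * Integrals of continuous functions over compact intervals *)

Definition itg {R : realType} (f : R -> R) (a b : R) : R :=
  \int[@lebesgue_measure R]_(x in `[a, b]) f x.

Section Itg.
Context {R : realType}.
Implicit Types (f g : R -> R) (a b c k e : R).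

Lemma itg_integrable f a b : continuous f ->
  (@lebesgue_measure R).-integrable `[a, b] (EFin \o f).
Proof.
move=> cf; apply: continuous_compact_integrable; first exact: segment_compact.
exact: continuous_subspaceT.
Qed.

Lemma itgD f g a b : continuous f -> continuous g ->
  itg (fun x => f x + g x) a b = itg f a b + itg g a b.
Proof. by move=> cf cg; apply: RintegralD => //; exact: itg_integrable. Qed.

Lemma itgB f g a b : continuous f -> continuous g ->
  itg (fun x => f x - g x) a b = itg f a b - itg g a b.
Proof. by move=> cf cg; apply: RintegralB => //; exact: itg_integrable. Qed.

Lemma itgZ f k a b : continuous f ->
  itg (fun x => k * f x) a b = k * itg f a b.
Proof. by move=> cf; apply: RintegralZl => //; exact: itg_integrable. Qed.

Lemma itg_cst k a b : a <= b -> itg (fun=> k) a b = k * (b - a).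
Proof.
move=> ab; transitivity (k * fine (@lebesgue_measure R `[a, b])).
  exact: Rintegral_cst.
rewrite lebesgue_measure_itv/= lte_fin.
by case: ltgtP ab => //= -> _; rewrite subrr.
Qed.

Lemma itg_le f g a b : continuous f -> continuous g ->
  (forall x, a <= x <= b -> f x <= g x) -> itg f a b <= itg g a b.
Proof.
move=> cf cg fg; apply: le_Rintegral => //; exact: itg_integrable.
Qed.

Lemma itg_chasles f a b c : continuous f -> a <= b -> b <= c ->
  itg f a c = itg f a b + itg f b c.
Proof.
move=> cf ab bc; rewrite /itg.
have ic := itg_integrable f _ _ cf.
have := @Rintegral_itvB R f (BLeft a) (BRight c) b (ic a c).
rewrite !bnd_simp => /(_ ab bc) H.
apply/eqP; rewrite addrC -subr_eq; apply/eqP; rewrite H.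
apply: Rintegral_itv_obnd_cbnd.
by apply: integrableS (ic b c) => //; exact: subset_itv_oc_cc.
Qed.

Lemma itg_ge_cst f k a b : continuous f -> a <= b ->
  (forall x, a <= x <= b -> k <= f x) -> k * (b - a) <= itg f a b.
Proof.
by move=> cf ab kf; rewrite -itg_cst//; apply: itg_le => // x; exact: cvg_cst.
Qed.

Lemma itg_le_cst f k a b : continuous f -> a <= b ->
  (forall x, a <= x <= b -> f x <= k) -> itg f a b <= k * (b - a).
Proof.
by move=> cf ab fk; rewrite -itg_cst//; apply: itg_le => // x; exact: cvg_cst.
Qed.

Lemma itg_dist f k e a b : continuous f -> a <= b ->
  (forall x, a <= x <= b -> `|f x - k| <= e) ->
  `|itg f a b - k * (b - a)| <= e * (b - a).
Proof.
move=> cf ab fk.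
have ccst (r : R) : continuous (fun _ : R => r) by move=> ?; exact: cvg_cst.
rewrite -itg_cst// -itgB//.
have cfk : continuous (fun x => f x - k).
  by move=> x; apply: cvgB; [exact: cf|exact: cvg_cst].
rewrite ler_norml -mulNr itg_ge_cst ?itg_le_cst// => x /fk;
  by rewrite ler_norml => /andP[].
Qed.

End Itg.

(** * Nested intervals and bisection of squares *)

Section Bisection.
Context {R : realType}.

(** Every left end lies below every right end, so the supremum of the left ends belongs to all the
    intervals. *)
Lemma nested_intervals (a l : nat -> R) : (forall n, 0 <= l n) ->
  (forall n, a n <= a n.+1) -> (forall n, a n.+1 + l n.+1 <= a n + l n) ->
  exists x, forall n, a n <= x <= a n + l n.
Proof.
move=> l0 a1 al1.
have a_mono m n : (m <= n)%N -> a m <= a n.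
  by move=> mn; apply: (homo_leq (@lexx _ R) le_trans a1 mn).
have al_mono m n : (m <= n)%N -> a n + l n <= a m + l m.
  move=> mn; rewrite -lerN2.
  apply: (@homo_leq R (fun n => - (a n + l n)) (fun x y => x <= y)) mn => //.
    by move=> y x z; exact: le_trans.
  by move=> k; rewrite lerN2.
have ub n k : a k <= a n + l n.
  case: (leqP k n) => [kn|/ltnW nk].
    by rewrite (le_trans (a_mono _ _ kn))// lerDl.
  by rewrite (le_trans _ (al_mono _ _ nk))// lerDl.
exists (sup (range a)) => n; apply/andP; split.
  apply: ub_le_sup; last by exists n.
  by exists (a 0%N + l 0%N) => _ [k _ <-].
by apply: ge_sup; [exists (a 0%N), 0%N | move=> _ [k _ <-]].
Qed.

(** If [m] is negative on a square, additivity makes it negative on one of the four quarters.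
    Iterating gives squares shrinking to a point [(x, y)], where the local hypothesis is violated.
    This is the subdivision argument of Goursat, with the analysis left out. *)
Lemma additive_square_ge0 (m : R -> R -> R -> R) :
  (forall a c l, 0 < l -> m a c (l + l) =
    m a c l + m (a + l) c l + m a (c + l) l + m (a + l) (c + l) l) ->
  (forall x y, exists2 d, 0 < d & forall a c l, 0 < l < d ->
    a <= x <= a + l -> c <= y <= c + l -> 0 <= m a c l) ->
  forall a c l, 0 < l -> 0 <= m a c l.
Proof.
move=> madd mloc a0 c0 l0 l0_gt0; rewrite leNgt; apply/negP => mneg.
(* The first negative quarter is chosen. The last one is taken untested: when the other three are
   nonnegative, additivity forces it to be negative. *)
pose step (q : R * R * R) := let: (a, c, l) := q in let h := l / 2 in
  if m a c h < 0 then (a, c, h) else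
  if m (a + h) c h < 0 then (a + h, c, h) else
  if m a (c + h) h < 0 then (a, c + h, h) else (a + h, c + h, h).
pose q n := iter n step (a0, c0, l0).
pose a n := (q n).1.1; pose c n := (q n).1.2; pose l n := (q n).2.
have lE n : l n = l0 / 2 ^+ n.
  elim: n => [|n IH]; first by rewrite expr0 divr1.
  have -> : l n.+1 = l n / 2.
    rewrite /l /q iterS -/(q n); case: (q n) => [[? ?] ?] /=.
    by do !case: ifP.
  by rewrite IH exprS invfM; lra.
have l_gt0 n : 0 < l n by rewrite lE divr_gt0// exprn_gt0.
have qneg n : m (a n) (c n) (l n) < 0.
  elim: n => //= n; move: (l_gt0 n.+1).
  rewrite /a /c /l /q iterS -/(q n); case: (q n) => [[x y] h] /=.
  case: ifPn => //= m1; case: ifPn => //= m2; case: ifPn => //= m3 h0.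
  move: m1 m2 m3; rewrite -!leNgt => m1 m2 m3.
  rewrite (_ : h = h / 2 + h / 2); last by lra.
  rewrite (madd _ _ _ h0) -(_ : h = h / 2 + h / 2); last by lra.
  by move=> H; lra.
have stepE n : [/\ a n <= a n.+1, c n <= c n.+1,
    a n.+1 + l n.+1 <= a n + l n & c n.+1 + l n.+1 <= c n + l n].
  move: (l_gt0 n) (l_gt0 n.+1).
  rewrite /a /c /l /q iterS -/(q n); case: (q n) => [[x y] h] /=.
  by do !case: ifPn; move=> /= *; split; lra.
have [x xa] : exists x, forall n, a n <= x <= a n + l n.
  by apply: nested_intervals => n; [exact: ltW|case: (stepE n)|case: (stepE n)].
have [y yc] : exists y, forall n, c n <= y <= c n + l n.
  by apply: nested_intervals => n; [exact: ltW|case: (stepE n)|case: (stepE n)].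
have [d d0 md] := mloc x y.
have [n ln] : exists n, l n < d.
  exists (Num.truncn (l0 / d)).+1; rewrite lE ltr_pdivrMr ?exprn_gt0//.
  rewrite mulrC -ltr_pdivrMr//.
  apply: (lt_trans (truncnS_gt (l0 / d))).
  by rewrite -natrX ltr_nat ltn_expl.
by move: (md _ _ _ (introT andP (conj (l_gt0 n) ln)) (xa n) (yc n)); rewrite leNgt qneg.
Qed.

End Bisection.

(** * The real-valued complex modulus *)

Section ComplexModulus.
Context {R : rcfType}.
Implicit Types (z w : R[i]) (x y : R).

Lemma cabsE z : cabs z = Normc.normc z.
Proof. by case: z. Qed.

Lemma cabs_norm z : `|z| = (cabs z)%:C%C.
Proof. by rewrite cabsE. Qed.

Lemma cabs_ge0 z : 0 <= cabs z.
Proof. exact: sqrtr_ge0. Qed.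

Lemma cabsM z w : cabs (z * w) = cabs z * cabs w.
Proof. by rewrite !cabsE Normc.normcM. Qed.

Lemma cabsV z : cabs z^-1 = (cabs z)^-1.
Proof. by rewrite !cabsE Normc.normcV. Qed.

Lemma cabsD z w : cabs (z + w) <= cabs z + cabs w.
Proof. by rewrite !cabsE le_normcD. Qed.

Lemma cabsN z : cabs (- z) = cabs z.
Proof. by rewrite !cabsE normcN. Qed.

Lemma cabs_eq0 z : (cabs z == 0) = (z == 0).
Proof.
apply/eqP/eqP; first by rewrite cabsE => /Normc.eq0_normc.
by move=> ->; rewrite cabsE Normc.normc0.
Qed.

Lemma cabs_gt0 z : (0 < cabs z) = (z != 0).
Proof. by rewrite lt_neqAle cabs_ge0 andbT eq_sym cabs_eq0. Qed.

Lemma cabs0 : cabs (0 : R[i]) = 0.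
Proof. by apply/eqP; rewrite cabs_eq0. Qed.

Lemma cabs_real x : cabs (x%:C%C : R[i]) = `|x|.
Proof. by rewrite /cabs/= expr0n addr0 sqrtr_sqr. Qed.

Lemma cabs_conj z : cabs (z^*)%C = cabs z.
Proof. by case: z => x y; rewrite /cabs/= sqrrN. Qed.

Lemma Re_le_cabs z : `|complex.Re z| <= cabs z.
Proof. by rewrite -sqrtr_sqr ler_wsqrtr// lerDl sqr_ge0. Qed.

Lemma Im_le_cabs z : `|complex.Im z| <= cabs z.
Proof. by rewrite -sqrtr_sqr ler_wsqrtr// lerDr sqr_ge0. Qed.

Lemma cabs_le_ReIm x y : cabs (x +i* y)%C <= `|x| + `|y|.
Proof.
rewrite -(ger0_norm (addr_ge0 (normr_ge0 x) (normr_ge0 y))) -sqrtr_sqr.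
rewrite ler_wsqrtr//= sqrrD !real_normK ?num_real//.
by have := mulr_ge0 (normr_ge0 x) (normr_ge0 y); lra.
Qed.

Lemma cabs_dist z w : `|cabs z - cabs w| <= cabs (z - w).
Proof.
have H (u v : R[i]) : cabs u - cabs v <= cabs (u - v).
  by rewrite lerBlDr -{1}(subrK v u) cabsD.
by rewrite ler_norml H lerNl opprB -(cabsN (z - w)) opprB H.
Qed.

Lemma ReB z w : complex.Re (z - w) = complex.Re z - complex.Re w.
Proof. by case: z w => [? ?] [? ?]. Qed.

Lemma ImB z w : complex.Im (z - w) = complex.Im z - complex.Im w.
Proof. by case: z w => [? ?] [? ?]. Qed.

End ComplexModulus.

(** * Goursat's theorem for squares, with one exceptional point *)

Section Goursat.
Context {R : realType}.
Local Notation C := R[i].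
Implicit Types (h : C -> C) (z w : C) (a b c d l e : R).

(** Continuity and differentiability are phrased with real epsilons and [cabs], so that all
    estimates stay in [R]; [cdiffP] below relates [cdiff] to [derivable]. *)
Definition ccont h z := forall e, 0 < e -> exists2 d, 0 < d &
  forall w, cabs w < d -> cabs (h (z + w) - h z) <= e.

Definition cdiff h z := exists L : C, forall e, 0 < e -> exists2 d, 0 < d &
  forall w, cabs w < d -> cabs (h (z + w) - h z - L * w) <= e * cabs w.

Lemma cdiff_ccont h z : cdiff h z -> ccont h z.
Proof.
move=> [L hL] e e0; have [d d0 hd] := hL 1 ltr01.
pose k := e / (1 + cabs L).
have L0 : 0 < 1 + cabs L by rewrite ltr_pwDl// cabs_ge0.
have k0 : 0 < k by rewrite divr_gt0.
exists (Num.min d k); first by rewrite lt_min d0 k0.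
move=> w; rewrite lt_min => /andP[wd wk].
have -> : h (z + w) - h z = (h (z + w) - h z - L * w) + L * w by rewrite subrK.
rewrite (le_trans (cabsD _ _))// cabsM.
have := hd _ wd; move: wk; rewrite /k ltr_pdivlMr// => wk H; nra.
Qed.

(** Asking only that [phi] and [gam] be 1-Lipschitz covers [Re], [Im] and [cabs] along horizontal
    and vertical lines at once. *)
Lemma ccont_continuous h (phi : C -> R) (gam : R -> C) :
  (forall z w, `|phi z - phi w| <= cabs (z - w)) ->
  (forall s t, cabs (gam s - gam t) <= `|s - t|) ->
  (forall z, ccont h z) -> continuous (fun t => phi (h (gam t))).
Proof.
move=> phi1 gam1 ch t; apply/cvgrPdist_le => e e0.
have [d d0 hd] := ch (gam t) e e0.
near=> s.
have st : `|t - s| < d by near: s; apply/nbhs_ballP; exists d.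
have ts : cabs (gam s - gam t) < d.
  by apply: (le_lt_trans (gam1 _ _)); rewrite distrC.
rewrite distrC; apply: (le_trans (phi1 _ _)).
by have := hd _ ts; rewrite subrKC.
Unshelve. all: by end_near. Qed.

Lemma ccont_horizontal h c : (forall z, ccont h z) ->
  continuous (fun x : R => complex.Im (h (x +i* c)%C)).
Proof.
apply: (ccont_continuous _ (@complex.Im R) (fun x => (x +i* c)%C)) => [z w|s t].
  by rewrite -ImB Im_le_cabs.
by rewrite (le_trans (cabs_le_ReIm _ _))// subrr normr0 addr0.
Qed.

Lemma ccont_vertical h a : (forall z, ccont h z) ->
  continuous (fun y : R => complex.Re (h (a +i* y)%C)).
Proof.
apply: (ccont_continuous _ (@complex.Re R) (fun y => (a +i* y)%C)) => [z w|s t].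
  by rewrite -ReB Re_le_cabs.
by rewrite (le_trans (cabs_le_ReIm _ _))// subrr normr0 add0r.
Qed.

Lemma ccont_real h (phi : C -> R) : (forall z w, `|phi z - phi w| <= cabs (z - w)) ->
  (forall z, ccont h z) -> continuous (fun x : R => phi (h x%:C%C)).
Proof.
move=> phi1; apply: (ccont_continuous _ phi (fun x => x%:C%C)) => // s t.
by rewrite -rmorphB cabs_real.
Qed.

(* The imaginary part of the contour integral of [h] around the square
   [a, a + l] x [c, c + l]. *)
Definition square_integral h a c l : R :=
  itg (fun x => complex.Im (h (x +i* c)%C)) a (a + l)
  - itg (fun x => complex.Im (h (x +i* (c + l))%C)) a (a + l)
  + itg (fun y => complex.Re (h ((a + l) +i* y)%C)) c (c + l)
  - itg (fun y => complex.Re (h (a +i* y)%C)) c (c + l).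

(** Each inner edge is shared by two quarters, which run through it in opposite directions, so its
    contributions cancel. *)
Lemma square_integral_split h a c l : (forall z, ccont h z) -> 0 < l ->
  square_integral h a c (l + l) =
    square_integral h a c l + square_integral h (a + l) c l +
    square_integral h a (c + l) l + square_integral h (a + l) (c + l) l.
Proof.
move=> ch l0; have ha := fun c => ccont_horizontal _ c ch.
have va := fun c => ccont_vertical _ c ch.
rewrite /square_integral !addrA.
do !rewrite [itg _ a (a + l + l)](@itg_chasles _ _ _ (a + l)) ?lerDl ?(ltW l0)//.
do !rewrite [itg _ c (c + l + l)](@itg_chasles _ _ _ (c + l)) ?lerDl ?(ltW l0)//.
ring.
Qed.

(** For the affine function itself, the horizontal sides contribute [- v1 * l * l] and the vertical
    ones [v1 * l * l], where [v1] is the real part of [v], so the total is 0. Each pair of opposite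
    sides adds an error of at most [2 * e * l]. *)
Lemma square_integral_affine h (u v z0 : C) a c l e : (forall z, ccont h z) ->
  0 <= l -> (forall x y, a <= x <= a + l -> c <= y <= c + l ->
    cabs (h (x +i* y)%C - (u + v * ((x +i* y)%C - z0))) <= e) ->
  `|square_integral h a c l| <= 4 * e * l.
Proof.
move=> ch l0 hl.
have aal : a <= a + l by rewrite lerDl.
have ccl : c <= c + l by rewrite lerDl.
have ha := fun c => ccont_horizontal _ c ch.
have va := fun c => ccont_vertical _ c ch.
have hI x y (xa : a <= x <= a + l) (yc : c <= y <= c + l) :=
  le_trans (Im_le_cabs _) (hl x y xa yc).
have hR x y (xa : a <= x <= a + l) (yc : c <= y <= c + l) :=
  le_trans (Re_le_cabs _) (hl x y xa yc).
rewrite /square_integral -itgB// -addrA -itgB//.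
set D1 := itg _ _ _; set D2 := itg _ _ _.
case: u v z0 hI hR {hl} => [u1 u2] [v1 v2] [x0 y0] hI hR.
have H1 : `|D1 - (- v1 * l) * (a + l - a)| <= (2 * e) * (a + l - a).
  apply: itg_dist => //; first by move=> x; apply: cvgB; exact: ha.
  move=> x xa.
  have := hI x c xa (introT andP (conj (lexx c) ccl)).
  have := hI x (c + l) xa (introT andP (conj ccl (lexx _))).
  rewrite !ImB/= !ler_norml => /andP[? ?] /andP[? ?].
  by apply/andP; split; lra.
have H2 : `|D2 - (v1 * l) * (c + l - c)| <= (2 * e) * (c + l - c).
  apply: itg_dist => //; first by move=> x; apply: cvgB; exact: va.
  move=> y yc.
  have := hR a y (introT andP (conj (lexx a) aal)) yc.
  have := hR (a + l) y (introT andP (conj aal (lexx _))) yc.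
  rewrite !ReB/= !ler_norml => /andP[? ?] /andP[? ?].
  by apply/andP; split; lra.
move: H1 H2; rewrite !ler_norml => /andP[? ?] /andP[? ?].
by apply/andP; split; lra.
Qed.

(** The signed square root. It is increasing, and steep enough at 0 that the product of its
    increments over two intervals of length [l] containing 0 is at least [l]. *)
Let phi (s : R) : R := if 0 <= s then Num.sqrt s else - Num.sqrt (- s).

Let phi_mono s t : s <= t -> phi s <= phi t.
Proof.
move=> st; rewrite /phi; case: ifPn => s0; case: ifPn => t0.
- exact: ler_wsqrtr.
- by move: t0; rewrite (le_trans s0 st).
- by rewrite (@le_trans _ _ 0)// ?oppr_le0 sqrtr_ge0.
- by rewrite lerN2 ler_wsqrtr// lerN2.
Qed.

(** The increment is the sum of the square roots of [a + l] and [- a], whose square is at least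
    [(a + l) - a = l]. *)
Let phi_ge_sqrt a l : 0 < l -> a <= 0 <= a + l -> Num.sqrt l <= phi (a + l) - phi a.
Proof.
move=> l0 /andP[a0 al0].
have phi_al : phi (a + l) = Num.sqrt (a + l) by rewrite /phi al0.
have phi_a : phi a = - Num.sqrt (- a).
  rewrite /phi; case: ifPn => // a0'; have -> : a = 0 by apply/eqP; rewrite eq_le a0 a0'.
  by rewrite oppr0 sqrtr0 oppr0.
rewrite phi_al phi_a opprK.
set s := Num.sqrt (a + l); set t := Num.sqrt (- a).
have s0 : 0 <= s by exact: sqrtr_ge0.
have t0 : 0 <= t by exact: sqrtr_ge0.
have s2 : s ^+ 2 = a + l by rewrite sqr_sqrtr.
have t2 : t ^+ 2 = - a by rewrite sqr_sqrtr// oppr_ge0.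
rewrite -(ger0_norm (addr_ge0 s0 t0)) -sqrtr_sqr ler_wsqrtr//.
by rewrite sqrrD s2 t2; have := mulr_ge0 s0 t0; lra.
Qed.

(* Both the area and the product [(phi (a + l) - phi a) * (phi (c + l) - phi c)]
   are additive in the square; the former dominates the contour integral around
   points of differentiability, the latter dominates the side length, hence the
   contour integral, around the exceptional point. *)
Theorem goursat_square h a c l : (forall z, ccont h z) ->
  (forall z, z != 0 -> cdiff h z) -> 0 < l -> square_integral h a c l = 0.
Proof.
move=> ch dh l0.
(* Points of a square of side [l] are within [2 * l] of each other, so a point of differentiability
   gives the error [4 * (e * (2 * l)) * l], whence 8. At the origin the error is [4 * e * l], whence
   4. *)
pose M a c l := 8 * (l * l) + 4 * ((phi (a + l) - phi a) * (phi (c + l) - phi c)).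
(* With [s] equal to 1 and -1 this bounds the absolute value of the integral by [e * M a c l], for
   every positive [e]. *)
suff H s e : `|s| = 1 -> 0 < e -> 0 <= e * M a c l + s * square_integral h a c l.
  have M0 : 0 <= M a c l.
    by rewrite /M addr_ge0 ?mulr_ge0 ?subr_ge0 ?phi_mono ?lerDl ?(ltW l0).
  apply/eqP; rewrite -normr_le0; apply/ler_addgt0Pr => e e0; rewrite add0r.
  have M1 : 0 < 1 + M a c l by rewrite ltr_pwDl.
  have := H 1 (e / (1 + M a c l)); rewrite normr1 => /(_ erefl).
  have := H (-1) (e / (1 + M a c l)); rewrite normrN1 => /(_ erefl).
  have e0' : 0 < e / (1 + M a c l) by rewrite divr_gt0.
  move=> /(_ e0') H1 /(_ e0') H2.
  have : e / (1 + M a c l) * M a c l <= e.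
    by rewrite mulrAC ler_pdivrMr// ler_pM2l//; lra.
  by rewrite ler_norml => H3; apply/andP; split; lra.
move=> s1 e0.
apply: (@additive_square_ge0 _ (fun a c l => e * M a c l + s * square_integral h a c l)) => //.
  by move=> {}a {}c {}l {}l0; rewrite square_integral_split// /M (addrA a) (addrA c); ring.
have sle a' c' l' E : `|square_integral h a' c' l'| <= E ->
    E <= e * M a' c' l' -> 0 <= e * M a' c' l' + s * square_integral h a' c' l'.
  move=> H1 H2; have : `|s * square_integral h a' c' l'| <= e * M a' c' l'.
    by rewrite normrM s1 mul1r (le_trans H1).
  by rewrite ler_norml => /andP[]; lra.
have phi0 a' l' : 0 < l' -> 0 <= phi (a' + l') - phi a'.
  by move=> ?; rewrite subr_ge0 phi_mono// lerDl ltW.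
move=> x y; have [xy0|xy0] := eqVneq (x +i* y)%C 0.
  move: xy0 => [-> ->] {x y}.
  have [d d0 hd] := ch 0 e e0.
  exists (d / 2); first by rewrite divr_gt0.
  move=> {}a {}c {}l /andP[{}l0 ld] a0 c0.
  apply: (sle _ _ _ (4 * e * l)).
    apply: (@square_integral_affine h (h 0) 0 0) => //; first exact: ltW.
    move=> x y xa yc; rewrite mul0r addr0 -[(x +i* y)%C]add0r; apply: hd.
    apply: (le_lt_trans (cabs_le_ReIm _ _)).
    have : `|x| <= l by rewrite ler_norml; apply/andP; split; lra.
    have : `|y| <= l by rewrite ler_norml; apply/andP; split; lra.
    by lra.
  rewrite /M; have := ler_pM (sqrtr_ge0 _) (sqrtr_ge0 _)
    (phi_ge_sqrt _ _ l0 a0) (phi_ge_sqrt _ _ l0 c0).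
  rewrite -expr2 sqr_sqrtr ?(ltW l0)// => H.
  have : 0 <= l * l by rewrite mulr_ge0// ltW.
  by move=> H2; rewrite (mulrC 4) -mulrA ler_pM2l//; lra.
have [L hL] := dh _ xy0.
have [d d0 hd] := hL e e0.
exists (d / 2); first by rewrite divr_gt0.
move=> {}a {}c {}l /andP[{}l0 ld] a0 c0.
apply: (sle _ _ _ (4 * (e * (2 * l)) * l)).
  apply: (@square_integral_affine h (h (x +i* y)%C) L (x +i* y)%C) => //; first exact: ltW.
  move=> x' y' xa yc.
  have wl : cabs ((x' +i* y')%C - (x +i* y)%C) <= 2 * l.
    apply: (le_trans (cabs_le_ReIm _ _)).
    have : `|x' - x| <= l by rewrite ler_norml; apply/andP; split; lra.
    have : `|y' - y| <= l by rewrite ler_norml; apply/andP; split; lra.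
    by lra.
  have wd : cabs ((x' +i* y')%C - (x +i* y)%C) < d by lra.
  have := hd _ wd; rewrite (addrC (x +i* y)%C) subrK opprD addrA => H.
  by rewrite (le_trans H)// ler_pM2l.
rewrite /M; have : 0 <= (phi (a + l) - phi a) * (phi (c + l) - phi c).
  by rewrite mulr_ge0// phi0.
by move=> H; rewrite (_ : 4 * _ * l = e * (8 * (l * l))) ?ler_pM2l//; [lra|ring].
Qed.

End Goursat.

(** * Rules of complex differentiation and the complex exponential *)

Section ComplexDifferentiability.
Context {R : realType}.
Local Notation C := R[i].
Implicit Types (h g : C -> C) (z w : C).

Lemma gt0_complexE (e : C) : 0 < e -> e = (complex.Re e)%:C%C /\ 0 < complex.Re e.
Proof. by case: e => a b; rewrite ltcE/= => /andP[/eqP -> ?]. Qed.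

Lemma cdiffP h z : cdiff h z <-> derivable (h : C^o -> C^o) z 1.
Proof.
split.
  move=> [L hL]; apply/cvg_ex; exists L; apply/cvgrPdist_le => e.
  move=> /gt0_complexE[-> e0]; have [d d0 hd] := hL _ e0.
  have d0' : 0 < (d%:C%C : C) by rewrite ltcR.
  apply/nbhs_ballP; exists d%:C%C => //= w.
  rewrite /ball/= sub0r normrN cabs_norm ltcR => wd w0.
  have w0' : 0 < cabs w by rewrite cabs_gt0.
  rewrite [w%:A]mulr1 cabs_norm lecR -[_ *: _]/(_ * _) -(ler_pM2r w0') -cabsM.
  rewrite (_ : (L - _) * w = - (h (z + w) - h z - L * w)); last by rewrite (addrC z); field.
  by rewrite cabsN; exact: hd.
move=> /cvg_ex[/= L] /cvgrPdist_le hL; exists L => e e0.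
have e0' : 0 < (e%:C%C : C) by rewrite ltcR.
have /nbhs_ballP[d /= /gt0_complexE[-> d0] hd] := hL _ e0'.
exists (complex.Re d) => // w wd.
have [->|w0] := eqVneq w 0; first by rewrite addr0 subrr mulr0 subrr cabs0 mulr0.
have w0' : 0 < cabs w by rewrite cabs_gt0.
have := hd w; rewrite /ball/= sub0r normrN cabs_norm ltcR => /(_ wd w0).
rewrite [w%:A]mulr1 cabs_norm lecR -[_ *: _]/(_ * _) -(ler_pM2r w0') -cabsM.
rewrite (_ : (L - _) * w = - (h (z + w) - h z - L * w)); last by rewrite (addrC z); field.
by rewrite cabsN.
Qed.

Lemma cdiff_cst (k : C) z : cdiff (fun=> k) z.
Proof. by apply/cdiffP; exact: derivable_cst. Qed.

Lemma cdiff_id z : cdiff id z.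
Proof. by apply/cdiffP; exact: derivable_id. Qed.

Lemma cdiffD h g z : cdiff h z -> cdiff g z -> cdiff (fun w => h w + g w) z.
Proof.
move=> /cdiffP dh /cdiffP dg; apply/cdiffP.
by have := @derivableD _ _ _ (h : C^o -> C^o) g z 1 dh dg.
Qed.

Lemma cdiffM h g z : cdiff h z -> cdiff g z -> cdiff (fun w => h w * g w) z.
Proof.
move=> /cdiffP dh /cdiffP dg; apply/cdiffP.
by have := @derivableM _ _ (h : C^o -> C^o) g z 1 dh dg.
Qed.

Lemma cdiffV h z : h z != 0 -> cdiff h z -> cdiff (fun w => (h w)^-1) z.
Proof.
move=> h0 /cdiffP dh; apply/cdiffP.
by have := @derivableV _ _ (h : C^o -> C^o) z 1 h0 dh.
Qed.

Lemma cdiff_comp h g z : cdiff g z -> cdiff h (g z) -> cdiff (fun w => h (g w)) z.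
Proof.
move=> /cdiffP/derivable1_diffP dg /cdiffP/derivable1_diffP dh.
apply/cdiffP/derivable1_diffP.
exact: (@differentiable_comp _ _ _ _ (g : C^o -> C^o) (h : C^o -> C^o) z dg dh).
Qed.

(** Schwarz reflection: the derivative at [z] is the conjugate of the derivative of [h] at the
    conjugate point. *)
Lemma cdiff_conj h z : cdiff h (z^*)%C -> cdiff (fun w => ((h (w^*)%C)^*)%C) z.
Proof.
move=> [L hL]; exists (L^*)%C => e e0; have [d d0 hd] := hL e e0.
exists d => // w wd; have := hd (w^*)%C; rewrite !cabs_conj => /(_ wd).
rewrite -cabs_conj !rmorphB rmorphM/= conjcK.
by rewrite rmorphD.
Qed.

Definition cexp z : C :=
  (expR (complex.Re z))%:C%C * (cos (complex.Im z) +i* sin (complex.Im z))%C.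

Lemma cexpD z w : cexp (z + w) = cexp z * cexp w.
Proof.
case: z w => [x y] [x' y']; rewrite /cexp /= expRD cosD sinD.
by apply/eqP; rewrite eq_complex/=; apply/andP; split; apply/eqP; ring.
Qed.

Lemma cexp0 : cexp 0 = 1.
Proof.
rewrite /cexp /= expR0 cos0 sin0.
by apply/eqP; rewrite eq_complex/= !mulr0 !mul0r !mulr1 subr0 addr0 !eqxx.
Qed.

Lemma cabs_cexp z : cabs (cexp z) = expR (complex.Re z).
Proof.
rewrite cabsM cabs_real ger0_norm ?expR_ge0// /cabs /= cos2Dsin2 sqrtr1.
by rewrite mulr1.
Qed.

Lemma is_derive0_bound (f : R -> R) (df : R) : is_derive (0:R) (1:R) f df ->
  forall e, 0 < e -> exists2 d, 0 < d &
    forall x, `|x| < d -> `|f x - f 0 - df * x| <= e * `|x|.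
Proof.
move=> [/cvg_ex[/= L hL] fL] e e0.
have Ldf : L = df by rewrite -fL; apply/esym/cvg_lim.
move: hL; rewrite {}Ldf => /cvgrPdist_le /(_ _ e0) /nbhs_ballP[d /= d0 hd].
exists d => // x xd; have [->|x0] := eqVneq x 0.
  by rewrite subrr mulr0 subrr normr0 mulr0.
have := hd x; rewrite /ball/= sub0r normrN => /(_ xd x0).
rewrite -[_ *: _]/(_ * _) -[x *: 1]/(x * 1) mulr1 addr0.
have x0' : 0 < `|x| by rewrite normr_gt0.
rewrite -(ler_pM2r x0') -normrM mulrBl mulrAC mulVf// mul1r.
by rewrite -normrN opprB.
Qed.

(** The functional equation reduces the claim to the point 0, where it follows from the first-order
    expansions of [expR], [cos] and [sin]. *)
Lemma cdiff_cexp z : cdiff cexp z.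
Proof.
suff H e : 0 < e -> exists2 d, 0 < d &
    forall w, cabs w < d -> cabs (cexp w - 1 - w) <= e * cabs w.
  exists (cexp z) => e e0.
  have ez : 0 < cabs (cexp z) by rewrite cabs_cexp expR_gt0.
  have [|d d0 hd] := H (e / cabs (cexp z)); first by rewrite divr_gt0.
  exists d => // w /hd hw; rewrite cexpD.
  rewrite (_ : _ - _ - _ * w = cexp z * (cexp w - 1 - w)); last by ring.
  by rewrite cabsM mulrC -ler_pdivlMr// mulrAC.
(* The errors below add up to [k * |x| + 5 * (k * |y|)], at most [6 * k] times the modulus, which
   explains [e / 6]. *)
move=> e0; pose k := Num.min (e / 6) 1.
have k0 : 0 < k by rewrite lt_min divr_gt0 /=.
have k1 : k <= 1 by rewrite ge_min lexx orbT.
have ke : 6 * k <= e by rewrite mulrC -ler_pdivlMr// ge_min lexx.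
have [d1 d10 h1] := is_derive0_bound _ _ (@is_derive_expR R 0) _ k0.
have [d2 d20 h2] := is_derive0_bound _ _ (@is_derive_cos R 0) _ k0.
have [d3 d30 h3] := is_derive0_bound _ _ (@is_derive_sin R 0) _ k0.
move: h1 h2 h3; rewrite expR0 sin0 cos0 oppr0 => h1 h2 h3.
(* The radius [k / 2] makes [|E - 1| <= 2 * |x| <= k], which controls the mixed term
   [(E - 1) * y]. *)
exists (Num.min (k / 2) (Num.min d1 (Num.min d2 d3))).
  by rewrite !lt_min divr_gt0// d10 d20 d30.
move=> [x y]; rewrite !lt_min => /and4P[wk w1 w2 w3].
have xw : `|x| <= cabs (x +i* y)%C := Re_le_cabs (x +i* y)%C.
have yw : `|y| <= cabs (x +i* y)%C := Im_le_cabs (x +i* y)%C.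
have H1 : `|expR x - 1 - x| <= k * `|x|.
  by have := h1 x (le_lt_trans xw w1); rewrite mul1r.
have H2 : `|cos y - 1| <= k * `|y|.
  by have := h2 y (le_lt_trans yw w2); rewrite mul0r subr0.
have H3 : `|sin y - y| <= k * `|y|.
  by have := h3 y (le_lt_trans yw w3); rewrite mul1r addr0.
set E := expR x in H1 *.
have E0 : 0 < E by exact: expR_gt0.
have EB : `|E - 1| <= 2 * `|x|.
  rewrite -[E - 1](subrK x) (le_trans (ler_normD _ _))//.
  by have : k * `|x| <= `|x| by [rewrite ler_piMl]; lra.
have E2 : E <= 2 by move: EB; rewrite ler_norml => /andP[]; lra.
have -> : cexp (x +i* y)%C - 1 - (x +i* y)%C =
    ((E - 1 - x + E * (cos y - 1)) +i* (E * (sin y - y) + (E - 1) * y))%C.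
  by apply/eqP; rewrite eq_complex /cexp /= -/E; apply/andP; split; apply/eqP; ring.
apply: (le_trans (cabs_le_ReIm _ _)).
have N1 : `|E - 1 - x + E * (cos y - 1)| <= k * `|x| + 2 * (k * `|y|).
  apply: (le_trans (ler_normD _ _)); apply: lerD => //.
  by rewrite normrM (ger0_norm (ltW E0)) ler_pM ?(ltW E0).
have N2 : `|E * (sin y - y) + (E - 1) * y| <= 2 * (k * `|y|) + k * `|y|.
  apply: (le_trans (ler_normD _ _)); apply: lerD.
    by rewrite normrM (ger0_norm (ltW E0)) ler_pM ?(ltW E0).
  by rewrite normrM ler_wpM2r//; lra.
set m := cabs _ in xw yw *.
have kx : k * `|x| <= k * m by rewrite ler_pM2l.
have ky : k * `|y| <= k * m by rewrite ler_pM2l.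
have km : 6 * k * m <= e * m by rewrite ler_wpM2r// cabs_ge0.
by lra.
Qed.

End ComplexDifferentiability.

(** * The value at 0 of a function that is real on the real axis *)

Section RealAxisBound.
Context {R : realType}.
Local Notation C := R[i].

Lemma abs_sin_le (u : R) : `|sin u| <= `|u|.
Proof.
wlog u0 : u / 0 <= u.
  move=> H; case: (leP 0 u) => [|/ltW u0]; first exact: H.
  by rewrite -normrN -sinN -(normrN u) H// oppr_ge0.
have [|c _] := @MVT_segment R sin cos 0 u u0 (fun x _ => is_derive_sin x).
  by apply: continuous_subspaceT; exact: continuous_sin.
by rewrite sin0 !subr0 => ->; rewrite normrM ler_piMl// cos_max.
Qed.

(** The disc of radius [cabs z] about [z] avoids the origin, so only values off the origin
    matter. *)
Lemma cdiff_near (h g : C -> C) z : z != 0 -> (forall w, w != 0 -> h w = g w) ->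
  cdiff g z -> cdiff h z.
Proof.
move=> z0 hg [L gL]; exists L => e e0; have [d d0 gd] := gL e e0.
exists (Num.min d (cabs z)); first by rewrite lt_min d0 cabs_gt0.
move=> w; rewrite lt_min => /andP[wd wz]; rewrite !hg//; first exact: gd.
by apply: contraTneq wz => /eqP; rewrite addr_eq0 => /eqP ->; rewrite cabsN ltxx.
Qed.

(** Filling in the derivative at 0 makes the quotient continuous there, which is all that
    [goursat_square] asks of the exceptional point. *)
Lemma divided_difference (f : C -> C) : (forall z, cdiff f z) ->
  exists h : C -> C, [/\ forall z, z != 0 -> h z = (f z - f 0) / z,
    forall z, ccont h z & forall z, z != 0 -> cdiff h z].
Proof.
move=> df; have [L fL] := df 0.
pose h z := if z == 0 then L else (f z - f 0) / z.
have hE z : z != 0 -> h z = (f z - f 0) / z by rewrite /h => /negPf ->.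
have dh z : z != 0 -> cdiff h z.
  move=> z0; apply: (cdiff_near _ _ _ z0 hE); apply: cdiffM.
    by apply: cdiffD => //; exact: cdiff_cst.
  by apply: (cdiffV id) => //; exact: cdiff_id.
exists h; split => // z; have [->|z0] := eqVneq z 0; last exact/cdiff_ccont/dh.
move=> e e0; have [d d0 fd] := fL e e0; exists d => // w wd.
rewrite add0r; have [->|w0] := eqVneq w 0; first by rewrite subrr cabs0 ltW.
have w0' : 0 < cabs w by rewrite cabs_gt0.
rewrite hE// /h eqxx -(ler_pM2r w0') -cabsM mulrBl divfK//.
by have := fd _ wd; rewrite add0r.
Qed.

Lemma ImM_ofreal (x : R) (w : C) : complex.Im (w * x%:C%C) = complex.Im w * x.
Proof. by case: w => a b /=; rewrite mulr0 add0r. Qed.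

Variables (G : C -> C) (A s T lam : R).
Hypotheses (dG : forall z, cdiff G z)
  (G_real : forall x : R, complex.Im (G x%:C%C) = 0)
  (G0_ge0 : 0 <= complex.Re (G 0))
  (G_exp : forall z, cabs (G z) <= A * expR (s * cabs z))
  (s0 : 0 <= s) (T0 : 0 < T) (lam0 : 0 < lam).

(** The linear term gives decay upwards, the quadratic one decay on the vertical sides. The
    coefficient 3 outweighs the growth of [lam * y ^+ 2 / T] up to height [2 * T], so that
    [Re q <= - (lam * T)] on the three upper sides. *)
Let q z : C := (0 +i* (3 * lam))%C * z + (- (lam / T))%:C%C * (z * z).
Let psi z : C := cexp (q z).
Let f z : C := G z * psi z.
Let g0 : R := complex.Re (G 0).

Let df z : cdiff f z.
Proof.
apply: cdiffM => //; apply: (cdiff_comp cexp q); last exact: cdiff_cexp.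
have d_id := @cdiff_id R z.
exact: (cdiffD _ _ _ (cdiffM _ id _ (cdiff_cst _ _) d_id)
  (cdiffM _ _ _ (cdiff_cst _ _) (cdiffM id id _ d_id d_id))).
Qed.

Let f0 : f 0 = g0%:C%C.
Proof.
rewrite /f /psi /q !mulr0 addr0 cexp0 mulr1 /g0.
by have := G_real 0; case: (G 0) => a b /= ->.
Qed.

Let Re_q (x y : R) : complex.Re (q (x +i* y)%C) =
  - (3 * lam * y + lam * (x ^+ 2 - y ^+ 2) / T).
Proof. by rewrite /q /=; ring. Qed.

Let Im_q_real (x : R) : complex.Im (q x%:C%C) = 3 * lam * x.
Proof. by rewrite /q /=; ring. Qed.

(** The factor [|x|] will absorb the division by [x] in the divided difference. *)
Let psi_bound (x : R) : `|complex.Im (psi x%:C%C)| <= 3 * lam * `|x|.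
Proof.
have -> : complex.Im (psi x%:C%C) = expR (complex.Re (q x%:C%C)) * sin (3 * lam * x).
  by rewrite -Im_q_real /psi /cexp; case: (q _) => a b /=; rewrite mul0r addr0.
have Rq : complex.Re (q x%:C%C) <= 0.
  rewrite (Re_q x 0) oppr_le0 mulr0 add0r expr0n subr0.
  by rewrite mulr_ge0 ?invr_ge0 ?(ltW T0)// mulr_ge0 ?(ltW lam0)// sqr_ge0.
rewrite normrM ger0_norm ?expR_ge0// (le_trans (ler_piMl _ _))//.
  by rewrite -expR0 ler_expR.
have l3 : 0 <= 3 * lam by rewrite mulr_ge0// ltW.
by rewrite -{2}(ger0_norm l3) -normrM abs_sin_le.
Qed.

Let eta : R := A * expR ((3 * s - lam) * T) / T.

Let A_ge0 : 0 <= A.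
Proof.
have := le_trans (cabs_ge0 (G 0)) (G_exp 0).
by rewrite pmulr_lge0// expR_gt0.
Qed.

Let side_bound (x y : R) : (x ^+ 2 = T ^+ 2 /\ 0 <= y <= 2 * T) \/
    (- T <= x <= T /\ y = 2 * T) ->
  cabs (f (x +i* y)%C / (x +i* y)%C) <= eta /\
  T ^+ 2 <= x ^+ 2 + y ^+ 2 <= 5 * T ^+ 2.
Proof.
move=> H.
have Rq : complex.Re (q (x +i* y)%C) <= - (lam * T).
  rewrite Re_q lerN2 -(ler_pM2r T0) mulrDl divfK ?gt_eqF//.
  case: H => [[-> /andP[y0 yT]]|[_ ->]].
    rewrite -subr_ge0.
    rewrite (_ : _ - _ = lam * (y * (2 * T - y) + y * T)); last by ring.
    by rewrite mulr_ge0 ?(ltW lam0)// addr_ge0// mulr_ge0 ?subr_ge0// ltW.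
  rewrite -subr_ge0 (_ : _ - _ = lam * (T ^+ 2 + x ^+ 2)); last by ring.
  by rewrite mulr_ge0 ?(ltW lam0)// addr_ge0// sqr_ge0.
have N : T ^+ 2 <= x ^+ 2 + y ^+ 2 <= 5 * T ^+ 2.
  case: H => [[-> /andP[y0 yT]]|[/andP[x1 x2] ->]].
    have := sqr_ge0 y; have : 0 <= (2 * T - y) * (2 * T + y).
      by rewrite mulr_ge0 ?subr_ge0// addr_ge0// mulr_ge0// ltW.
    by move=> h1 h2; apply/andP; split; lra.
  have := sqr_ge0 x; have := sqr_ge0 T; have : 0 <= (T - x) * (T + x).
    by rewrite mulr_ge0 ?subr_ge0//; lra.
  by move=> h1 h2 h3; apply/andP; split; lra.
split => //; have /andP[N1 N2] := N.
have cT : T <= cabs (x +i* y)%C.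
  by rewrite -(ger0_norm (ltW T0)) -sqrtr_sqr ler_wsqrtr.
have c3T : cabs (x +i* y)%C <= 3 * T.
  have T3 : 0 <= 3 * T by rewrite mulr_ge0// ltW.
  rewrite -(ger0_norm T3) -sqrtr_sqr ler_wsqrtr//= (le_trans N2)//.
  by have := sqr_ge0 T; lra.
rewrite cabsM cabsV /eta /f cabsM /psi cabs_cexp.
have c0 : 0 < cabs (x +i* y)%C by exact: lt_le_trans cT.
apply: ler_pM; rewrite ?invr_ge0 ?cabs_ge0//.
- by rewrite mulr_ge0 ?cabs_ge0 ?expR_ge0.
- apply: (@le_trans _ _ (A * expR (s * (3 * T)) * expR (- (lam * T)))).
    apply: ler_pM; rewrite ?cabs_ge0 ?expR_ge0// ?ler_expR//.
    by rewrite (le_trans (G_exp _))// ler_wpM2l// ler_expR ler_wpM2l.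
  by rewrite -mulrA -expRD le_eqVlt; apply/orP; left; apply/eqP; congr (_ * expR _); ring.
- by rewrite lef_pV2.
Qed.

(** By Goursat the bottom integral equals the sum of the other three with outward signs. Each of
    these has length [2 * T] and contributes at least [(k - eta) * (2 * T)]; here [6 * T * k] is
    [6 / 5 * g0], which exceeds [g0], and [6 * T * eta] is the error term. *)
Theorem value_le_integral_aux :
  g0 <= 3 * lam * itg (fun x => `|complex.Re (G x%:C%C)|) (- T) T
        + 6 * (A * expR ((3 * s - lam) * T)).
Proof.
have [h [hE ch dh]] := divided_difference _ df.
have G0 := goursat_square _ (- T) 0 (2 * T) ch dh (mulr_gt0 (ltr0Sn _ 1) T0).
have ha := fun c => ccont_horizontal _ c ch.
have va := fun c => ccont_vertical _ c ch.
(* The numerator of the relevant part of [g0 / z] is at least [g0 * T] in absolute value and the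
   denominator at most [5 * T ^+ 2]. *)
pose k := g0 / (5 * T).
have k_le u v : 0 <= u -> T <= u -> T ^+ 2 <= v <= 5 * T ^+ 2 -> k <= g0 * (u / v).
  move=> u0 uT /andP[v1 v2]; rewrite /k ler_wpM2l//.
  have T2 : 0 < T ^+ 2 by rewrite exprn_gt0.
  have v0 : 0 < v by lra.
  rewrite ler_pdivlMr// mulrC ler_pdivrMr ?mulr_gt0// (le_trans v2)//.
  by rewrite expr2 mulrCA ler_wpM2r// mulr_ge0// ltW.
have hReIm x y : T ^+ 2 <= x ^+ 2 + y ^+ 2 <= 5 * T ^+ 2 ->
    complex.Re (h (x +i* y)%C) =
      complex.Re (f (x +i* y)%C / (x +i* y)%C) - g0 * (x / (x ^+ 2 + y ^+ 2)) /\
    complex.Im (h (x +i* y)%C) =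
      complex.Im (f (x +i* y)%C / (x +i* y)%C) + g0 * (y / (x ^+ 2 + y ^+ 2)).
  move=> /andP[N1 _].
  have T2 : 0 < T ^+ 2 by rewrite exprn_gt0.
  have z0 : (x +i* y)%C != 0.
    apply/eqP => /eqP; rewrite eq_complex/= => /andP[/eqP x0 /eqP y0].
    by move: N1; rewrite x0 y0 expr0n/= addr0; lra.
  rewrite hE// mulrBl f0; case: (f _ / _) => a b /=; split; ring.
have T0' := T0.
have Tle : - T <= - T + 2 * T by lra.
have Tle' : 0 <= 0 + 2 * T by lra.
have I2 : (k - eta) * (- T + 2 * T - - T) <=
    itg (fun x => complex.Im (h (x +i* (0 + 2 * T))%C)) (- T) (- T + 2 * T).
  apply: itg_ge_cst => // x xT.
  have [|E N] := side_bound x (0 + 2 * T).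
    by right; split; [apply/andP; split; lra|rewrite add0r].
  have [_ ->] := hReIm _ _ N; rewrite addrC; apply: lerD.
    by have := le_trans (Im_le_cabs _) E; rewrite ler_norml => /andP[].
  by apply: k_le => //; lra.
have I3 : itg (fun y => complex.Re (h ((- T + 2 * T) +i* y)%C)) 0 (0 + 2 * T) <=
    (eta - k) * (0 + 2 * T - 0).
  apply: itg_le_cst => // y yT.
  have [|E N] := side_bound (- T + 2 * T) y.
    by left; split; [ring|rewrite add0r in yT].
  have [-> _] := hReIm _ _ N; apply: lerB.
    by have := le_trans (Re_le_cabs _) E; rewrite ler_norml => /andP[].
  by apply: k_le => //; lra.
have I4 : (k - eta) * (0 + 2 * T - 0) <=
    itg (fun y => complex.Re (h ((- T) +i* y)%C)) 0 (0 + 2 * T).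
  apply: itg_ge_cst => // y yT.
  have [|E N] := side_bound (- T) y.
    by left; split; [ring|rewrite add0r in yT].
  have [-> _] := hReIm _ _ N; rewrite mulNr mulrN opprK addrC; apply: lerD.
    by have := le_trans (Re_le_cabs _) E; rewrite ler_norml => /andP[].
  by apply: k_le => //; lra.
have cReG : continuous (fun x : R => complex.Re (G x%:C%C)).
  apply: ccont_real => [z w|z]; first by rewrite -ReB Re_le_cabs.
  exact: cdiff_ccont.
have cG : continuous (fun x : R => `|complex.Re (G x%:C%C)|).
  by move=> x; apply: cvg_norm; exact: cReG.
have c3G : continuous (fun x : R => 3 * lam * `|complex.Re (G x%:C%C)|).
  by move=> x; apply: cvgM; [exact: cvg_cst|exact: cG].
have hx x : x != 0 ->
    complex.Im (h (x +i* 0)%C) <= 3 * lam * `|complex.Re (G x%:C%C)|.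
  move=> x0; have x0' : (x%:C%C : C) != 0 by rewrite -cabs_gt0 cabs_real normr_gt0.
  rewrite -[(x +i* 0)%C]/(x%:C%C : C) hE// f0 -fmorphV ImM_ofreal ImB subr0.
  (* The subtracted [f 0] is real and drops out of the imaginary part; [G] is real here, so only the
     imaginary part of [psi] remains. *)
  rewrite (_ : complex.Im _ = complex.Re (G x%:C%C) * complex.Im (psi x%:C%C)); last first.
    by rewrite /f; have := G_real x; case: (G _) (psi _) => a b [a' b'] /= ->; ring.
  rewrite (le_trans (ler_norm _))// !normrM normfV ler_pdivrMr ?normr_gt0//.
  rewrite mulrAC [leRHS]mulrC ler_wpM2l//.
have I1 : itg (fun x => complex.Im (h (x +i* 0)%C)) (- T) (- T + 2 * T) <=
    3 * lam * itg (fun x => `|complex.Re (G x%:C%C)|) (- T) T.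
  rewrite -itgZ// (_ : - T + 2 * T = T); last by ring.
  apply: itg_le => // x _; have [->|] := eqVneq x 0; last exact: hx.
  (* The formula for [h] fails at 0, so there the inequality is the limit of the one at nonzero
     points. *)
  apply: (@ler_cvg_to R ((0 : R)^')%classic _ R
    (fun x => complex.Im (h (x +i* 0)%C))
    (fun x => 3 * lam * `|complex.Re (G x%:C%C)|)).
  - exact: (cvg_trans (cvg_app _ (@cvg_within _ _ _ _)) (ha 0 0)).
  - exact: (cvg_trans (cvg_app _ (@cvg_within _ _ _ _)) (c3G 0)).
  - by near=> t; apply: hx; near: t; exact: nbhs_dnbhs_neq.
have Teta : 6 * T * eta = 6 * (A * expR ((3 * s - lam) * T)).
  by rewrite /eta; field; rewrite gt_eqF.
have Tk : 6 * T * k = 6 / 5 * g0 by rewrite /k; field; rewrite gt_eqF.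
move: G0; rewrite /square_integral.
by have := G0_ge0; rewrite -/g0; lra.
Unshelve. all: by end_near. Qed.

End RealAxisBound.

(** * Symmetrisation, and translation of integrals *)

Section ValueBound.
Context {R : realType}.
Local Notation C := R[i].

(** A unimodular [u] turns [G 0] into its modulus. The average [H] of [u * G] and its Schwarz
    reflection obeys the same growth bound, equals the real part of [u * G] on the real axis, and
    has value [cabs (G 0)] at 0. *)
Lemma value_le_integral (G : C -> C) (A s T lam : R) :
  (forall z, cdiff G z) -> (forall z, cabs (G z) <= A * expR (s * cabs z)) ->
  0 <= s -> 0 < T -> 0 < lam ->
  cabs (G 0) <= 3 * lam * itg (fun x => cabs (G x%:C%C)) (- T) T
                + 6 * (A * expR ((3 * s - lam) * T)).
Proof.
move=> dG G_exp s0 T0 lam0.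
have [u u1 uG] : exists2 u : C, cabs u = 1 & u * G 0 = (cabs (G 0))%:C%C.
  have [G00|G00] := eqVneq (G 0) 0.
    exists 1; last by rewrite mul1r G00 cabs0.
    by rewrite -[1]/((1:R)%:C%C) cabs_real normr1.
  have c0 : cabs (G 0) != 0 by rewrite cabs_eq0.
  exists ((G 0)^*%C * (cabs (G 0))^-1%:C%C).
    by rewrite cabsM cabs_conj cabs_real ger0_norm ?invr_ge0 ?cabs_ge0// divff.
  rewrite mulrAC; case: (G 0) c0 => a b; rewrite /cabs /= => c0.
  apply/eqP; rewrite eq_complex/=; apply/andP; split; apply/eqP; last by ring.
  have c2 : Num.sqrt (a ^+ 2 + b ^+ 2) ^+ 2 = a ^+ 2 + b ^+ 2.
    by rewrite sqr_sqrtr// addr_ge0// sqr_ge0.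
  rewrite mulr0 subr0 (_ : a * a - - b * b = a ^+ 2 + b ^+ 2); last by ring.
  by rewrite -[X in X / _]c2 expr2 mulfK.
pose H z := (2^-1)%:C%C * (u * G z + ((u * G (z^*)%C)^*)%C).
have dH z : cdiff H z.
  apply: cdiffM; first exact: cdiff_cst.
  apply: cdiffD; first by apply: cdiffM => //; exact: cdiff_cst.
  by apply: (@cdiff_conj R (fun z => u * G z)); apply: cdiffM => //; exact: cdiff_cst.
have HE (x : R) : H x%:C%C = (complex.Re (u * G x%:C%C))%:C%C.
  rewrite /H conjc_real; case: (u * _) => a b.
  by apply/eqP; rewrite eq_complex/=; apply/andP; split; apply/eqP; field.
have H0 : H 0 = (cabs (G 0))%:C%C by rewrite (HE 0) uG.
have uGabs z : cabs (u * G z) = cabs (G z) by rewrite cabsM u1 mul1r.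
have H_exp z : cabs (H z) <= A * expR (s * cabs z).
  rewrite cabsM cabs_real ger0_norm ?invr_ge0// ler_pdivrMl//.
  rewrite (le_trans (cabsD _ _))// cabs_conj !uGabs.
  have := G_exp z; have := G_exp (z^*)%C; rewrite cabs_conj; lra.
have cabsG : continuous (fun x : R => cabs (G x%:C%C)).
  apply: ccont_real => [z w|z]; [exact: cabs_dist|exact: cdiff_ccont].
have := @value_le_integral_aux R H A s T lam dH _ _ H_exp s0 T0 lam0.
rewrite H0 /= => /(_ (fun x => _)) H1.
apply: (le_trans (H1 _ _)); [by move=> x; rewrite HE|exact: cabs_ge0|].
rewrite lerD2r ler_wpM2l ?mulr_ge0 ?(ltW lam0)//; apply: itg_le => //.
  move=> x; apply: cvg_norm; apply: ccont_real => [z w|z].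
    by rewrite -ReB Re_le_cabs.
  exact: cdiff_ccont.
by move=> x _; rewrite HE/= -(uGabs x%:C%C) Re_le_cabs.
Qed.

Lemma itg_shift (c : R -> R) (a b r : R) : continuous c -> a <= b ->
  itg (fun x => c (r + x)) a b = itg c (r + a) (r + b).
Proof.
move=> cc ab; rewrite /itg /Rintegral.
have dF (x : R) : is_derive x 1 (fun x : R => r + x) 1.
  by rewrite -[X in is_derive _ _ _ X]add0r; apply: is_deriveD.
have cF : continuous (fun x : R => r + x).
  by move=> x; apply: cvgD; [exact: cvg_cst|exact: cvg_id].
have F1 : ((fun x : R => r + x)^`())%classic = cst 1.
  by apply/funext => x; rewrite derive1E; apply: derive_val.
rewrite (@integration_by_substitution_increasing R (fun x => r + x))//.
- by congr fine; apply: eq_integral => x _; rewrite F1 /= mulr1.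
- by move=> x y _ _ xy; rewrite ltrD2l.
- by rewrite F1 => x _; exact: cst_continuous.
- by rewrite F1; exact: is_cvg_cst.
- by rewrite F1; exact: is_cvg_cst.
- split.
  + by move=> x _; have [] := dF x.
  + by apply: cvg_at_right_filter; exact: cF.
  + by apply: cvg_at_left_filter; exact: cF.
- exact: continuous_subspaceT.
Qed.

Lemma itg_sub (c : R -> R) (a b a' b' : R) : continuous c -> (forall x, 0 <= c x) ->
  a' <= a -> a <= b -> b <= b' -> itg c a b <= itg c a' b'.
Proof.
move=> cc c0 a'a ab bb'.
have ge0 u v : 0 <= itg c u v by apply: Rintegral_ge0.
rewrite (@itg_chasles _ _ a' a b')// ?(le_trans ab)//.
by rewrite (@itg_chasles _ _ a b b')// addrCA lerDl addr_ge0.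
Qed.

End ValueBound.

(** * From one variable to the iterated integral over a cube *)

Definition upd {R : realType} (y : nat -> R) (n : nat) (t : R) : nat -> R :=
  fun i => if i == n then t else y i.

Section CubeIntegral.
Context {R : realType}.
Implicit Types (g : (nat -> R) -> R) (y a : nat -> R) (T K D : R).

Lemma upd_comm y m n s t : m != n -> upd (upd y m s) n t = upd (upd y n t) m s.
Proof.
move=> mn; apply/funext => i; rewrite /upd.
by case: eqVneq => // ->; rewrite eq_sym (negPf mn).
Qed.

(* No measurability is assumed: it is not available for the inner integrals of
   [cube_int]. *)
Lemma ge0_le_integral_nonmeasurable (T : R) (f k : R -> \bar R) :
  (forall x : R, - T <= x <= T -> (0 <= f x <= k x)%E) ->
  (\int[@lebesgue_measure R]_(x in sym_itv T) f x <=
   \int[@lebesgue_measure R]_(x in sym_itv T) k x)%E.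
Proof.
move=> fk; have f0 x : sym_itv T x -> (0 <= f x)%E.
  by rewrite /sym_itv/= in_itv => /fk /andP[].
have k0 x : sym_itv T x -> (0 <= k x)%E.
  by rewrite /sym_itv/= in_itv => /fk /andP[/le_trans]; apply.
(* The integral of a nonnegative function is a supremum over the simple functions below it, and a
   larger function has more of them. *)
rewrite !ge0_integralE//; apply: le_ereal_sup => _ [h hf <-]; exists h => // x.
apply: (le_trans (hf x)); rewrite /patch; case: ifPn => // /set_mem.
by rewrite /sym_itv/= in_itv => /fk /andP[].
Qed.

Lemma cube_int_ge0 T n (g : (nat -> R) -> \bar R) : (forall y, 0 <= g y)%E ->
  (0 <= cube_int T n g)%E.
Proof.
elim: n g => [|n IH] g g0 //=; apply: integral_ge0 => t _.
by apply: IH => y; exact: g0.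
Qed.

(** Induction on the number of variables: the hypothesis for [n] bounds the value on each slice by
    the inner integral, this is integrated over the last coordinate, and the one-variable inequality
    is applied once more. The error obeys [D' = 2 * K * T * Dn + D], which is at most
    [(1 + 2 * K * T) * Dn]. The zeros at indices from [n] on match the default in [cube_int]. *)
Lemma value_le_cube_int T K D n g a : 0 <= T -> 0 < K -> 0 <= D ->
  (forall y, 0 <= g y) ->
  (forall y m, (m < n)%N -> continuous (fun t => g (upd y m t))) ->
  (forall i, `|a i| <= T) ->
  (forall y m, (m < n)%N -> (forall i, `|y i| <= T) ->
    g (upd y m (a m)) <= K * itg (fun t => g (upd y m t)) (- T) T + D) ->
  forall B, (cube_int T n (EFin \o g) <= B%:E)%E ->
  g (fun i => if (i < n)%N then a i else 0) <=
    K ^+ n * B + D * (1 + 2 * K * T) ^+ n.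
Proof.
move=> T0 K0 D0 g0 cg aT; elim: n g g0 cg => [|n IH] g g0 cg Hg B /=.
  by rewrite lee_fin !expr0 mul1r mulr1 => /le_trans; apply; rewrite lerDl.
pose y0 i : R := if (i < n)%N then a i else 0.
pose c t := g (upd y0 n t).
have y0T i : `|y0 i| <= T by rewrite /y0; case: ifP => // _; rewrite normr0.
have cc : continuous c by exact: cg.
pose Dn := D * (1 + 2 * K * T) ^+ n.
have Dn0 : 0 <= Dn by rewrite mulr_ge0// exprn_ge0// addr_ge0// !mulr_ge0// ltW.
have Kn : 0 < K ^+ n by rewrite exprn_gt0.
(* A continuous minorant of the inner integral. *)
pose v t := Num.max 0 ((c t - Dn) / K ^+ n).
have cv : continuous v.
  move=> t.
  apply: (@continuous_max _ _ (fun _ : R => 0) (fun t => (c t - Dn) / K ^+ n)).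
    exact: cst_continuous.
  by apply: cvgM; [apply: cvgB; [exact: cc|]|]; exact: cvg_cst.
have cvK t : c t <= K ^+ n * v t + Dn.
  rewrite -lerBlDr mulrC -ler_pdivrMr//.
  by rewrite le_max lexx orbT.
have v_le t : - T <= t <= T ->
    (0 <= (v t)%:E <= cube_int T n (fun x => ((EFin \o g) (upd x n t))))%E.
  move=> tT; rewrite lee_fin le_max lexx/=.
  have I0 : (0 <= cube_int T n (fun x => ((EFin \o g) (upd x n t))))%E.
    by apply: cube_int_ge0 => y; rewrite lee_fin.
  (* An inner integral may be infinite, and then the bound is trivial; a finite value serves as [B]
     in the induction hypothesis. *)
  case E : (cube_int T n _) I0 => [r| |]//; last by move=> _; exact: leey.
  rewrite !lee_fin ge_max => r0; rewrite r0/= ler_pdivrMr// lerBlDr mulrC.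
  apply: (IH (fun x => g (upd x n t))) => //.
  - move=> y m mn; rewrite (_ : (fun _ => _) = (fun s => g (upd (upd y n t) m s))).
      by apply: cg; rewrite ltnW.
    by apply/funext => s; rewrite upd_comm// ltn_eqF.
  - move=> y m mn yT; rewrite upd_comm ?ltn_eqF//.
    rewrite (_ : (fun _ => _) = (fun s => g (upd (upd y n t) m s))).
      apply: Hg; first by rewrite ltnW.
      by move=> i; rewrite /upd; case: eqP => // _; rewrite ler_norml.
    by apply/funext => s; rewrite upd_comm// ltn_eqF.
  - by rewrite -E.
move=> gB.
have vB : itg v (- T) T <= B.
  have W := le_trans (ge0_le_integral_nonmeasurable _ _ _ v_le) gB.
  rewrite -lee_fin; apply: le_trans W.
  rewrite /itg /Rintegral fineK//.
  by apply: integrable_fin_num => //; exact: itg_integrable.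
have cB : itg c (- T) T <= K ^+ n * B + Dn * (2 * T).
  apply: (@le_trans _ _ (itg (fun t => K ^+ n * v t + Dn) (- T) T)).
    apply: itg_le => //.
    by move=> t; apply: cvgD; [apply: cvgM; [exact: cvg_cst|exact: cv]|exact: cvg_cst].
  rewrite itgD; last 2 first.
  - by move=> t; apply: cvgM; [exact: cvg_cst|exact: cv].
  - by move=> t; exact: cvg_cst.
  rewrite itgZ// itg_cst; last by lra.
  apply: lerD; first by rewrite ler_pM2l.
  by rewrite ler_wpM2l//; lra.
rewrite (_ : (fun i => _) = upd y0 n (a n)); last first.
  apply/funext => i; rewrite /upd /y0 ltnS leq_eqVlt.
  by case: eqVneq => [->|].
apply: (le_trans (Hg y0 n (ltnSn n) y0T)).
apply: (@le_trans _ _ (K * (K ^+ n * B + Dn * (2 * T)) + D)).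
  by rewrite lerD2r ler_pM2l.
have D1 : D <= Dn.
  rewrite /Dn ler_peMr// exprn_ege1// lerDl.
  by rewrite !mulr_ge0// ltW.
by rewrite !exprS (mulrCA D) -/Dn; lra.
Qed.

End CubeIntegral.

(** * One-variable slices, and the growth of cube integrals *)

Section Slices.
Context {R : realType} {p : nat}.
Local Notation C := R[i].
Implicit Types (y : nat -> R) (F : 'rV[C^o]_p -> C^o).

Definition point y : 'rV[R]_p := \row_(i < p) y i.

Definition slice F (y : nat -> R) (j : 'I_p) (z : C) : C :=
  F (embedC (point y) + z *: delta_mx 0 j).

Lemma cdiff_slice F y j : entire F -> forall z, cdiff (slice F y j) z.
Proof.
move=> dF z; apply/cdiffP.
have := @diff_derivable _ _ _ F (embedC (point y) + z *: delta_mx 0 j)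
  (delta_mx 0 j) (dF _).
rewrite /derivable => dFz.
rewrite (_ : (fun h => _) = (fun h : C^o => h^-1 *:
  ((F \o shift (embedC (point y) + z *: delta_mx 0 j)) (h *: delta_mx 0 j)
   - F (embedC (point y) + z *: delta_mx 0 j))))//.
apply/funext => h /=; congr (_ *: (F _ - _)).
by rewrite [h%:A]mulr1 scalerDl addrCA.
Qed.

Lemma slice_real F y (j : 'I_p) (t x : R) :
  slice F (upd y j t) j x%:C%C = F (embedC (point (upd y j (t + x)))).
Proof.
congr F; apply/rowP => i; rewrite !mxE /upd eqxx /=.
case: (eqVneq i j) => [->|ij]; first by rewrite eqxx mulr1 -rmorphD.
by rewrite (_ : (i == j :> nat) = false) ?mulr0 ?addr0//; apply/negbTE.
Qed.

(** The Euclidean norm is at most the sum of the moduli of the coordinates. *)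
Lemma eucl_norm_slice y (j : 'I_p) (z : C) (T : R) : (forall i, `|y i| <= T) ->
  eucl_norm (embedC (point y) + z *: delta_mx 0 j) <= p%:R * T + cabs z.
Proof.
move=> yT.
have sqrt_sum (I : Type) (s : seq I) (c : I -> R) : (forall i, 0 <= c i) ->
    Num.sqrt (\sum_(i <- s) c i ^+ 2) <= \sum_(i <- s) c i.
  move=> c0; have S0 : 0 <= \sum_(i <- s) c i by exact: sumr_ge0.
  rewrite -[leRHS](ger0_norm S0) -sqrtr_sqr ler_wsqrtr//.
  elim: s {S0} => [|i s IH]; first by rewrite !big_nil expr0n.
  rewrite !big_cons sqrrD; have S0 : 0 <= \sum_(i <- s) c i by exact: sumr_ge0.
  by have := mulr_ge0 (c0 i) S0; lra.
rewrite /eucl_norm (le_trans (sqrt_sum _ _ _ _))//; first by move=> i; exact: cabs_ge0.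
apply: (@le_trans _ _ (\sum_(i < p) (T + (if i == j then cabs z else 0)))).
  apply: ler_sum => i _; rewrite !mxE (le_trans (cabsD _ _))// lerD//.
    by rewrite cabs_real.
  rewrite cabsM eqxx /=; case: eqP => _; last by rewrite -[(_ *+ _)]/(0 : C) cabs0 mulr0.
  by rewrite -[(_ *+ _)]/((1 : R)%:C%C) cabs_real normr1 mulr1.
rewrite big_split/= sumr_const card_ord -big_mkcond big_pred1_eq mulr_natl.
exact: lexx.
Qed.

Lemma besicovitch_norm_lty (f : 'rV[R]_p -> C) : (besicovitch_norm f < +oo)%E ->
  exists B T1 : R, [/\ 0 <= B, 1 <= T1 &
    forall T, T1 <= T -> (cube_int_abs f T <= (B * T ^+ p)%:E)%E].
Proof.
rewrite /besicovitch_norm /limf_esup => /ereal_inf_lt[_ [V [M [_ MV]] <-] SV].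
set S := ereal_sup _ in SV.
(* The factor [2 ^+ p] comes from the normalisation by [(2 * T) ^- p]. A neighbourhood of infinity
   contains only the points strictly beyond [M], hence [M + 1]. *)
exists (Num.max 0 (fine S) * 2 ^+ p), (Num.max 1 (M + 1)); split.
- by rewrite mulr_ge0 ?exprn_ge0// le_max lexx.
- by rewrite le_max lexx.
move=> T; rewrite ge_max => /andP[T1 TM].
have T0 : 0 < (2 * T) ^- p by rewrite invr_gt0 exprn_gt0//; lra.
have c0 : (0 <= cube_int_abs f T)%E.
  by apply: cube_int_ge0 => y; rewrite lee_fin cabs_ge0.
have cS : (((2 * T) ^- p)%:E * cube_int_abs f T <= S)%E.
  by apply: ereal_sup_ubound; exists T => //; apply: MV; lra.
have : (((2 * T) ^- p)%:E * cube_int_abs f T <= (Num.max 0 (fine S))%:E)%E.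
  apply: (le_trans cS); case: S SV {cS} => [r| |]//= _; last exact: leNye.
  by rewrite lee_fin le_max lexx orbT.
case: (cube_int_abs f T) c0 => [r| |]// _.
  rewrite !lee_fin mulrC ler_pdivrMr; last by rewrite -invr_gt0.
  by rewrite exprMn mulrA.
by rewrite gt0_muley ?lte_fin// leye_eq.
Qed.

End Slices.

(** * The polynomial bound *)

Theorem theorem2 (R : realType) (p : nat) (sigma C0 : R)
  (f : 'rV[R]_p -> complex R)
  (F : 'rV[(complex R)^o]_p -> (complex R)^o) :
  (1 <= p)%N -> 0 < sigma -> 0 < C0 ->
  (* f locally integrable: finite integral of |f| over every cube *)
  (forall T : R, 0 < T -> (cube_int_abs f T < +oo)%E) ->
  (* finite Besicovitch norm *)
  (besicovitch_norm f < +oo)%E ->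
  (* f extends to an entire function F on C^p of exponential type *)
  entire F ->
  (forall x : 'rV[R]_p, F (embedC x) = f x) ->
  (forall z : 'rV[complex R]_p, cabs (F z) <= C0 * expR (sigma * eucl_norm z)) ->
  exists C1 : R, forall x : 'rV[R]_p,
    cabs (f x) <= C1 * \prod_(j < p) (1 + `|x ord0 j|) ^+ p.
Proof.
move=> _ sigma0 C0_gt0 _ bf dF Ff F_exp.
have [B [T1 [B0 T1_ge1 bT]]] := besicovitch_norm_lty _ bf.
(* On a slice through the cube of half-side [2 * T] the growth constant is
   [C0 * expR (sigma * (p%:R * (2 * T)))]. This [lam] makes the total exponent of the error term
   exactly 0, leaving the error [6 * C0]. *)
pose lam := (2 * p%:R + 3) * sigma.
have lam0 : 0 < lam by rewrite mulr_gt0// ltr_wpDl// mulr_ge0.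
pose K := 3 * lam; have K0 : 0 < K by rewrite mulr_gt0.
pose D := 6 * C0; have D0 : 0 < D by rewrite mulr_gt0.
exists ((K ^+ p * (B * 2 ^+ p) + D * (1 + 4 * K) ^+ p) * T1 ^+ p) => x.
pose Q := \prod_(j < p) (1 + `|x ord0 j|).
have Q1 : 1 <= Q.
  by apply: (big_ind (fun r => 1 <= r)) => //; [exact: mulr_ege1|move=> i _; rewrite lerDl].
(* This [T] is at least [T1], so the Besicovitch bound applies; it dominates every coordinate of
   [x]; and [T ^+ p] is [T1 ^+ p] times the product wanted. *)
pose T := T1 * Q.
have T1T : T1 <= T by rewrite /T ler_peMr//; lra.
have T_gt0 : 0 < T by lra.
pose a (i : nat) : R := if insub i is Some j then x ord0 j else 0.
have aE (j : 'I_p) : a j = x ord0 j by rewrite /a valK.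
have aT i : `|a i| <= T.
  rewrite /a; case: insubP => [j _ _|_]; last by rewrite normr0 ltW.
  have xQ : 1 + `|x ord0 j| <= Q.
    rewrite /Q (bigD1 j)//= ler_peMr ?addr_ge0//.
    by apply: (big_ind (fun r => 1 <= r)) => //; [exact: mulr_ege1|move=> i' _; rewrite lerDl].
  have QT : Q <= T by rewrite /T ler_peMl//; lra.
  by lra.
pose g (y : nat -> R) := cabs (f (@point R p y)).
have gE (y : nat -> R) (j : 'I_p) t s :
    cabs (slice F (upd y j t) j s%:C%C) = g (upd y j (t + s)).
  by rewrite slice_real Ff.
have cg (y : nat -> R) m : (m < p)%N -> continuous (fun t => g (upd y m t)).
  move=> mp; pose j := Ordinal mp.
  have := @ccont_real R (slice F (upd y j 0) j) (@cabs R) (@cabs_dist R)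
    (fun z => cdiff_ccont _ _ (cdiff_slice _ _ j dF z)).
  rewrite (_ : (fun x => _) = (fun t => g (upd y m t)))//.
  by apply/funext => t; rewrite gE add0r.
have gx : g (fun i => if (i < p)%N then a i else 0) = cabs (f x).
  rewrite /g; congr (cabs (f _)); apply/rowP => j; rewrite mxE ltn_ord aE.
  by rewrite (ord1 ord0).
have T2 : T1 <= 2 * T by lra.
(* The half-side is [2 * T] because the interval of radius [T] about a coordinate of [x] must lie
   inside the cube. *)
have H := @value_le_cube_int R (2 * T) K D p g a _ K0 (ltW D0) _ cg _ _ _ (bT _ T2).
rewrite -gx; apply: le_trans (H _ _ _ _) _.
- by lra.
- by move=> y; exact: cabs_ge0.
- by move=> i; rewrite (le_trans (aT i))//; lra.
- move=> y m mp yT; pose j := Ordinal mp.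
  have yaT i : `|upd y m (a m) i| <= 2 * T.
    by rewrite /upd; case: eqP => // _; rewrite (le_trans (aT _))//; lra.
  have expG z : cabs (slice F (upd y j (a m)) j z) <=
      (C0 * expR (sigma * (p%:R * (2 * T)))) * expR (sigma * cabs z).
    rewrite -mulrA -expRD -mulrDr; apply: (le_trans (F_exp _)).
    rewrite ler_pM2l// ler_expR ler_pM2l//.
    exact: eucl_norm_slice.
  have := value_le_integral _ _ _ T lam (cdiff_slice _ _ j dF) expG (ltW sigma0) T_gt0 lam0.
  rewrite gE addr0 => /le_trans; apply; apply: lerD.
    rewrite ler_pM2l// (_ : (fun _ => _) = (fun t => g (upd y m (a m + t)))); last first.
      by apply/funext => t; rewrite gE.
    rewrite (@itg_shift R (fun t => g (upd y m t))); [|exact: cg|lra].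
    have := aT m; rewrite ler_norml => /andP[am1 am2].
    apply: itg_sub; [exact: cg| |lra|lra|lra].
    by move=> t; exact: cabs_ge0.
  rewrite /D -mulrA -expRD (_ : sigma * _ + _ = 0); first by rewrite expR0 mulr1.
  by rewrite /lam; ring.
rewrite prodrXl -/Q.
have -> : (2 * T) ^+ p = 2 ^+ p * (T1 ^+ p * Q ^+ p) by rewrite !exprMn.
(* Since [T >= 1], the summand 1 is at most [T], which makes the error [O(T ^+ p)] as well. *)
have X : (1 + 2 * K * (2 * T)) ^+ p <= (1 + 4 * K) ^+ p * (T1 ^+ p * Q ^+ p).
  rewrite -!exprMn -/T; have K0' := ltW K0; have T0' := ltW T_gt0.
  apply: lerXn2r; rewrite ?nnegrE; last by lra.
    by rewrite addr_ge0// mulr_ge0// mulr_ge0.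
  by rewrite mulr_ge0// addr_ge0// mulr_ge0.
rewrite -[leRHS]mulrA [leRHS]mulrDl; apply: lerD; first by rewrite !mulrA.
by rewrite -[leRHS]mulrA ler_pM2l.
Qed.
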